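(* Let $H\in(\tfrac12,1)$, let $B^H$ be a one-dimensional fractional Brownian motion with Hurst parameter $H$, and let $X_0\in\mathbb{R}\setminus\{0\}$ be a constant. Let $f,g:[0,\infty)\times\mathbb{R}\to\mathbb{R}$, and let $\kappa\ge2H$, $\lambda>0$, $\bar\lambda>0$, $\mu>0$ be constants such that either $\kappa>2H$ (and $\lambda>0$), or $\kappa=2H$ and $-\lambda+\mu^2<0$. Consider the following conditions, each required for all $t>0$ and $x\in\mathbb{R}$: (M) $x f(t,x)\le-\lambda\kappa t^{\kappa-1}x^2$; (F) $|f(t,x)|\le\bar\lambda\kappa t^{\kappa-1}|x|$; (G) $|g(t,x)|\le\mu|x|$. Fix $\Delta t>0$, put $t_n=n\Delta t$ and $V_n^H=B^H(t_{n+1})-B^H(t_n)$, and let $(X_n)_{n\ge0}$ be a sequence of random variables, started at $X_0$, given by the stochastic theta method (STM) for the equation $dX(t)=f(t,X(t))\,dt+g(t,X(t))\,dB^H(t)$, that is, $$X_{n+1}=X_n+\theta f(t_{n+1},X_{n+1})\Delta t+(1-\theta)f(t_n,X_n)\Delta t+g(t_n,X_n)V_n^H,\qquad n\ge0.$$ Then: (i) If (M) and (G) hold, then the STM with $\theta=1$ (the backward Euler method) is mean square stable, i.e. $\lim_{n\to\infty}\mathbb{E}|X_n|^2=0$. (ii) If (M), (F) and (G) hold, then the STM with $\frac{\sqrt6\,e\,\bar\lambda/\lambda}{\sqrt6\,e\,\bar\lambda/\lambda+1}\le\theta<1$ is mean square stable, i.e. $\lim_{n\to\infty}\mathbb{E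}|X_n|^2=0$.
   Context: A fractional Brownian motion with Hurst parameter $H$ is a centered Gaussian process $(B^H(t))_{t\ge0}$ with covariance $\mathbb{E}[B^H(t)B^H(s)]=\frac12\left(t^{2H}+s^{2H}-|t-s|^{2H}\right)$. The numerical method is called mean square stable if its iterates satisfy $\lim_{n\to\infty}\mathbb{E}|X_n|^2=0$. *)

(* Defs.v *)
From HB Require Import structures.
From mathcomp Require Import all_boot all_order all_algebra.
From mathcomp Require Import all_classical all_reals all_analysis.

Set Implicit Arguments.
Unset Strict Implicit.
Unset Printing Implicit Defensive.

Import Order.TTheory GRing.Theory Num.Theory.
Import numFieldNormedType.Exports.

Local Open Scope classical_set_scope.
Local Open Scope ring_scope.

(* Point masses are included: normal_prob m 0 is, by a junk-value convention,
   the uniform law on [0, 1], so standard deviation 0 is treated apart. *)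
Definition gaussian_law (R : realType) (Q : set R -> \bar R) : Prop :=
  exists m s : R, 0 <= s /\
    forall A : set R, measurable A ->
      Q A = if s == 0 then \d_m A else normal_prob m s A.

(* Processes on [0, +oo[ are indexed by all of R; only the values at
   nonnegative times are constrained. *)
Definition gaussian_process d (T : measurableType d) (R : realType)
    (P : probability T R) (B : R -> {RV P >-> R}) : Prop :=
  forall (n : nat) (a t : 'I_n -> R), (forall i, 0 <= t i) ->
    gaussian_law (pushforward P (fun w => \sum_(i < n) a i * B (t i) w)).

Definition fractional_brownian_motion d (T : measurableType d) (R : realType)
    (P : probability T R) (H : R) (B : R -> {RV P >-> R}) : Prop :=
  [/\ gaussian_process B,
      forall t : R, 0 <= t -> 'E_P[B t]%E = 0%:E
    & forall t s : R, 0 <= t -> 0 <= s ->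
        'E_P[fun w => (B t w * B s w)%R]%E =
        (2^-1 * (t `^ (2 * H) + s `^ (2 * H) - `|t - s| `^ (2 * H)))%:E].

Definition condM (R : realType) (lambda kappa : R) (f : R -> R -> R) : Prop :=
  forall t x : R, 0 < t ->
    x * f t x <= - lambda * kappa * t `^ (kappa - 1) * x ^+ 2.

Definition condF (R : realType) (lambdabar kappa : R) (f : R -> R -> R)
    : Prop :=
  forall t x : R, 0 < t ->
    `|f t x| <= lambdabar * kappa * t `^ (kappa - 1) * `|x|.

Definition condG (R : realType) (mu : R) (g : R -> R -> R) : Prop :=
  forall t x : R, 0 < t -> `|g t x| <= mu * `|x|.

(* Equalities between random variables are understood P-almost surely. *)
Definition stochastic_theta_method d (T : measurableType d) (R : realType)
    (P : probability T R) (theta : R) (f g : R -> R -> R)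
    (B : R -> {RV P >-> R}) (dt x0 : R) (X : nat -> {RV P >-> R}) : Prop :=
  let t := fun n : nat => n%:R * dt in
  let V := fun (n : nat) (w : T) => B (t n.+1) w - B (t n) w in
  {ae P, forall w, X 0%N w = x0} /\
  forall n : nat, {ae P, forall w,
    X n.+1 w = X n w + theta * f (t n.+1) (X n.+1 w) * dt
               + (1 - theta) * f (t n) (X n w) * dt
               + g (t n) (X n w) * V n w}.

Definition mean_square_stable d (T : measurableType d) (R : realType)
    (P : probability T R) (X : nat -> {RV P >-> R}) : Prop :=
  'E_P[fun w => (`|X n w| ^+ 2)%R]%E @[n --> \oo] --> 0%:E.

(* Main.v *)
(* The majorant e^(c|v|) <= e^(cv) + e^(-cv) reduces the estimate of E|X_n|^2 to
   moment generating functions of linear combinations of the increments V_k,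
   which are Gaussian but strongly correlated.

   Write a_k = lambda kappa t_k^(kappa - 1) dt and let r = 1/(sqrt 6 e). Testing
   the implicit equation against X_(n+1) shows that Y_n = |X_n| (1 + theta a_n)
   satisfies Y_(n+1) <= Y_n (q_n + c_n |V_n|), where
   q_n = (1 + r theta a_n) / (1 + theta a_n) tends to r and
   c_n = mu / (1 + theta a_n). As q_n >= r, the factor is at most
   q_n exp(beta_n |V_n|) with beta_n = c_n / r. Expanding the product of the
   majorants over all signs gives
     E|X_n|^2 <= D prod_(k < n) (2 q_k^2) exp(2 sum_(i, j) beta_i beta_j s_ij),
   where s_ij = Cov(V_i, V_j) is nonnegative because H > 1/2. Put h = 2H - 1.
   Since beta_i = O(i^(-h)) (this uses kappa >= 2H) and the row sums of (s_ij)
   are O(n^h), the exponent is O(n^(1 - h(1 - h))) = o(n), whereas the product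
   decays geometrically because 2 r^2 < 1. *)
Require Import Defs.
From mathcomp Require Import all_boot all_order all_algebra.
From mathcomp Require Import all_classical all_reals all_analysis.
From mathcomp Require Import measurable_realfun simple_functions.
From mathcomp Require Import measurable_fun_approximation.
From mathcomp Require Import ring lra.
Set Implicit Arguments.
Unset Strict Implicit.
Unset Printing Implicit Defensive.
Import Order.TTheory GRing.Theory Num.Theory.
Import numFieldNormedType.Exports.
Local Open Scope classical_set_scope.
Local Open Scope ring_scope.

Lemma eq_ler (R : numDomainType) (x y : R) : x = y -> x <= y.
Proof. by move=> ->. Qed.

(** * Integration against a measure with a density *)

Section density.
Import HBNNSimple.
Context d (T : measurableType d) (R : realType).
Variables (m n : {measure set T -> \bar R}) (h : T -> R).
Hypotheses (mh : measurable_fun [set: T] h) (h0 : forall x, 0 <= h x).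
Hypothesis nE : forall A, measurable A -> n A = (\int[m]_(x in A) (h x)%:E)%E.

(** The hypothesis [nE] is the case of indicators; linearity extends it to simple functions, and
    monotone convergence to all nonnegative measurable ones. *)
Lemma ge0_integral_density (f : T -> \bar R) :
  measurable_fun [set: T] f -> (forall x, 0 <= f x)%E ->
  (\int[n]_x f x = \int[m]_x (f x * (h x)%:E))%E.
Proof.
have indic E : measurable E ->
    (\int[n]_x (\1_E x)%:E = \int[m]_x ((\1_E x)%:E * (h x)%:E))%E.
  move=> mE; rewrite integral_indic// setIT nE// integral_mkcond.
  apply: eq_integral => x _; rewrite patchE indicE.
  by case: (x \in E); rewrite ?mul1e ?mul0e.
have nnsfun (g : {nnsfun T >-> R}) :
    (\int[n]_x (g x)%:E = \int[m]_x ((g x)%:E * (h x)%:E))%E.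
  under [LHS]eq_integral do rewrite fimfunE -fsumEFin//.
  rewrite [LHS]ge0_integral_fsum//; last 2 first.
    - by move=> r; exact/measurable_EFinP/measurableT_comp.
    - by move=> r x _; rewrite EFinM nnfun_muleindic_ge0.
  have gE x : ((g x)%:E * (h x)%:E = \sum_(r \in range g)
      ((r * \1_(g @^-1` [set r]) x)%:E * (h x)%:E))%E.
    rewrite fimfunE -fsumEFin// ge0_mule_fsuml// => r.
    by rewrite EFinM nnfun_muleindic_ge0.
  under [RHS]eq_integral do rewrite gE.
  rewrite [RHS]ge0_integral_fsum//; last 2 first.
    - move=> r; apply: emeasurable_funM; last exact/measurable_EFinP.
      exact/measurable_EFinP/measurableT_comp.
    - move=> r x _; rewrite mule_ge0 ?lee_fin// -lee_fin EFinM.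
      exact: nnfun_muleindic_ge0.
  apply: eq_fsbigr => r _.
  rewrite integralZl_indic_nnsfun//= indic//.
  have [r0|r0] := leP 0%R r.
    rewrite -ge0_integralZl//.
    - by apply: eq_integral => x _; rewrite EFinM muleA.
    - apply: emeasurable_funM; last exact/measurable_EFinP.
      exact/measurable_EFinP/measurable_indic.
    - by move=> x _; rewrite mule_ge0// lee_fin.
  (* A negative value is not attained by a nonnegative function, so its preimage is empty and both
     sides vanish. *)
  rewrite preimage_nnfun0// indic0.
  rewrite [X in (_ * X)%E]integral0_eq ?mule0; last first.
    by move=> x _; rewrite mul0e.
  by rewrite integral0_eq// => x _; rewrite mulr0 mul0e.
move=> mf f0; pose f_ := nnsfun_approx measurableT mf.
transitivity (limn (fun k => \int[n]_x (f_ k x)%:E)%E).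
  rewrite -monotone_convergence//=.
  - apply: eq_integral => x _; apply/esym/cvg_lim => //=.
    exact: cvg_nnsfun_approx.
  - by move=> k; exact/measurable_EFinP.
  - by move=> k x _; rewrite lee_fin.
  - by move=> x _ i j ij; rewrite lee_fin; exact/lefP/nd_nnsfun_approx.
transitivity (limn (fun k => \int[m]_x ((f_ k x)%:E * (h x)%:E))%E).
  by apply: congr_lim; apply/funext => k; exact: nnsfun.
rewrite -monotone_convergence//=.
- apply: eq_integral => x _; apply/cvg_lim => //=.
  by apply: cvgeZr => //; exact: cvg_nnsfun_approx.
- move=> k; apply: emeasurable_funM => //; exact/measurable_EFinP.
- by move=> k x _; rewrite -EFinM lee_fin mulr_ge0.
- move=> x _ i j ij; rewrite -!EFinM lee_fin ler_wpM2r//.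
  exact/lefP/nd_nnsfun_approx.
Qed.
End density.

(** * Exponential integrals of normal laws *)

Section normal.
Context (R : realType).
Implicit Types (m s t e : R).

Lemma ge0_integral_normal_prob m s (f : R -> R) :
  measurable_fun [set: R] f -> (forall x, 0 <= f x) ->
  (\int[normal_prob m s]_x (f x)%:E =
   \int[lebesgue_measure]_x (f x * normal_pdf m s x)%:E)%E.
Proof.
move=> mf f0; under [RHS]eq_integral do rewrite EFinM.
apply: ge0_integral_density => //.
- exact: measurable_normal_pdf.
- by move=> x; exact: normal_pdf_ge0.
- exact/measurable_EFinP.
Qed.

(** Completing the square: the tilted density is a constant times the normal density with mean
    [m + t * s ^+ 2], whose integral is 1. *)
Lemma normal_prob_mgf m s t : s != 0 ->
  (\int[normal_prob m s]_x (expR (t * x))%:E =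
   (expR (t * m + t ^+ 2 * s ^+ 2 / 2))%:E)%E.
Proof.
move=> s0; rewrite ge0_integral_normal_prob//; last first.
  by apply: measurableT_comp => //; exact: measurable_funM.
under eq_integral => x _.
  rewrite (_ : _ * _ = expR (t * m + t ^+ 2 * s ^+ 2 / 2) *
                       normal_pdf (m + t * s ^+ 2) s x); last first.
    rewrite !normal_pdfE// /normal_fun mulrCA [RHS]mulrCA -!expRD.
    by congr (_ * expR _); field.
  rewrite EFinM; over.
rewrite ge0_integralZl//.
- by rewrite integral_normal_pdf mule1.
- by apply/measurable_EFinP; exact: measurable_normal_pdf.
- by move=> x _; rewrite lee_fin normal_pdf_ge0.
Qed.

Lemma normal_peak_div s k : 0 < k -> normal_peak (s / k) = k * normal_peak s.
Proof.
move=> k0; rewrite /normal_peak.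
rewrite (_ : _ *+ 2 = (s ^+ 2 * pi *+ 2) * (k^-1) ^+ 2); last first.
  by rewrite expr_div_n exprVn -!mulrnAr; ring.
rewrite sqrtrM; last by rewrite mulrn_wge0// mulr_ge0 ?sqr_ge0// pi_ge0.
by rewrite sqrtr_sqr ger0_norm ?invr_ge0 ?ltW// invfM invrK mulrC.
Qed.

(** The weight merges with the density into [k^-1] times the centered normal density of deviation
    [s / k], where k^2 = 1 + e s^2. *)
Lemma normal_prob0_expR_sqr s e : s != 0 -> 0 < e ->
  (\int[normal_prob 0 s]_x (expR (- (e * x ^+ 2 / 2)))%:E =
   ((Num.sqrt (1 + e * s ^+ 2))^-1)%:E)%E.
Proof.
move=> s0 e0; rewrite ge0_integral_normal_prob//; last first.
  do 2 apply: measurableT_comp => //.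
  by apply: measurable_funM => //; apply: measurable_funM => //.
set k := Num.sqrt _.
have k2 : k ^+ 2 = 1 + e * s ^+ 2.
  by rewrite sqr_sqrtr// addr_ge0// mulr_ge0 ?sqr_ge0// ltW.
have k0 : 0 < k.
  by rewrite sqrtr_gt0 ltr_pwDl// mulr_ge0 ?sqr_ge0// ltW.
have sk0 : s / k != 0 by rewrite mulf_neq0// invr_neq0// gt_eqF.
under eq_integral => x _.
  rewrite (_ : _ * _ = k^-1 * normal_pdf 0 (s / k) x); last first.
    rewrite normal_pdfE// normal_pdfE//=.
    rewrite -/(normal_peak _) -/(normal_peak (s / k)) normal_peak_div//.
    rewrite /normal_fun mulrCA -expRD !subr0 !mulrA mulVf ?gt_eqF// mul1r.
    congr (_ * expR _); rewrite expr_div_n k2.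
    field; rewrite s0/= gt_eqF//.
    by rewrite -k2 exprn_gt0.
  rewrite EFinM; over.
rewrite ge0_integralZl//.
- by rewrite integral_normal_pdf mule1.
- by apply/measurable_EFinP; exact: measurable_normal_pdf.
- by move=> x _; rewrite lee_fin normal_pdf_ge0.
- by rewrite lee_fin invr_ge0 ltW.
Qed.
End normal.

(** * Exponential moments of a centered Gaussian variable *)

Section gaussian.
Context d (T : measurableType d) (R : realType) (P : probability T R).

Lemma integrable_sqr_integrable (Y : T -> R) :
  measurable_fun [set: T] Y ->
  P.-integrable [set: T] (EFin \o (fun w => Y w ^+ 2)) ->
  P.-integrable [set: T] (EFin \o Y).
Proof.
move=> mY iY.
apply: (@le_integrable _ _ _ _ _ measurableT _
    (EFin \o (fun w => 1 + Y w ^+ 2))) => //.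
- exact/measurable_EFinP.
- move=> w _ /=; rewrite lee_fin [leRHS]ger0_norm; last first.
    by rewrite addr_ge0// sqr_ge0.
  have := sqr_ge0 (`|Y w| - 1); have := real_normK (num_real (Y w)).
  have := normr_ge0 (Y w); nra.
- rewrite (_ : EFin \o _ = (fun w => 1%:E + (Y w ^+ 2)%:E)%E)//.
  apply: integrableD => //; apply/integrableP; split => //.
  under eq_integral do rewrite /= normr1.
  by rewrite integral_cst//= mul1e probability_setT ltry.
Qed.

(** The parameters m and s supplied by [gaussian_law] have no stated link to the moments of Y.
    Exponential integrals provide it: they force m = 0 and s^2 <= v when s is nonzero, and m <= 0
    when s = 0. This suffices for an upper bound. *)
Lemma gaussian_expectation_expR (Y : T -> R) (v : R) :
  measurable_fun [set: T] Y ->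
  gaussian_law (pushforward P Y) -> 'E_P[Y]%E = 0%:E ->
  'E_P[fun w => (Y w ^+ 2)%R]%E = v%:E ->
  ('E_P[fun w => expR (Y w)] <= (expR (v / 2))%:E)%E.
Proof.
move=> mY [m [s [s0 law]]] EY0 EY2.
have [mI vI] : (P.-integrable [set: T] (EFin \o Y)) /\
    P.-integrable [set: T] (EFin \o (fun w => Y w ^+ 2)).
  have vI : P.-integrable [set: T] (EFin \o (fun w => Y w ^+ 2)).
    apply/integrableP; split; first exact/measurable_EFinP/measurable_funX.
    under eq_integral do rewrite /= ger0_norm ?sqr_ge0//.
    by move: EY2; rewrite unlock => ->; rewrite ltry.
  by split=> //; exact: integrable_sqr_integrable.
have v0 : 0 <= v.
  by rewrite -lee_fin -EY2; apply: expectation_ge0 => w; rewrite sqr_ge0.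
(* [normal_prob] lives on [measurableTypeR R], whose measurable sets are those
   of [R] but whose display differs. *)
pose Y' : T -> measurableTypeR R := Y.
have mY' : measurable_fun [set: T] Y' by exact: mY.
have transfer (f : measurableTypeR R -> R) :
    measurable_fun [set: measurableTypeR R] f ->
    (forall x, 0 <= f x) ->
    ('E_P[fun w => f (Y w)] = \int[pushforward P Y']_x (f x)%:E)%E.
  move=> mf f0; rewrite unlock ge0_integral_pushforward//.
    exact/measurable_EFinP.
  by move=> x _; rewrite lee_fin.
have mexp (t : R) : 
    measurable_fun [set: measurableTypeR R]
      (fun x : measurableTypeR R => expR (t * x)).
  by apply: measurableT_comp => //; exact: measurable_funM.
have ge1 (t c : R) : 'E_P[fun w => expR (t * Y w)]%E = c%:E -> 1 <= c.
  move=> tc; rewrite -lee_fin -tc.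
  have -> : 1%:E = (\int[P]_w (1%:E + t%:E * (Y w)%:E))%E.
    rewrite integralD//=; last 2 first.
    - apply/integrableP; split => //.
      under eq_integral do rewrite /= normr1.
      by rewrite integral_cst//= mul1e probability_setT ltry.
    - exact: integrableZl.
    rewrite integral_cst//= mul1e probability_setT integralZl//.
    by move: EY0; rewrite unlock => ->; rewrite mule0 adde0.
  rewrite unlock; apply: le_integral => //.
  - apply: integrableD => //; last exact: integrableZl.
    apply/integrableP; split => //.
    under eq_integral do rewrite /= normr1.
    by rewrite integral_cst//= mul1e probability_setT ltry.
  - apply/integrableP; split.
      apply/measurable_EFinP.
      exact: (measurableT_comp (mexp t)).
    under eq_integral do rewrite /= ger0_norm ?expR_ge0//.
    by move: tc; rewrite unlock => ->; rewrite ltry.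
  - by move=> w _; rewrite -EFinM -EFinD lee_fin; exact: expR_ge1Dx.
(* For a point mass, E exp(- Y) >= 1 gives m <= 0, hence E exp(Y) = exp(m) <= 1. *)
have [s_eq0|s_neq0] := eqVneq s 0.
  have mgf t : 'E_P[fun w => expR (t * Y w)]%E = (expR (t * m))%:E.
    rewrite (transfer (fun x => expR (t * x)))//.
    rewrite (eq_measure_integral (\d_(m : measurableTypeR R))) => [|A mA _].
      rewrite integral_dirac//; first by rewrite diracT mul1e.
      exact/measurable_EFinP.
    by have := law A mA; rewrite s_eq0 eqxx.
  have := ge1 _ _ (mgf (-1)); rewrite -[leLHS]expR0 ler_expR => m0.
  rewrite (_ : (fun w => _) = (fun w => expR (1 * Y w))); last first.
    by apply/funext => w; rewrite mul1r.
  rewrite mgf lee_fin ler_expR; lra.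
have lawE (f : measurableTypeR R -> \bar R) :
    (\int[pushforward P Y']_x f x = \int[normal_prob m s]_x f x)%E.
  apply: eq_measure_integral => A mA _.
  by have := law A mA; rewrite (negbTE s_neq0).
have mgf t : 'E_P[fun w => expR (t * Y w)]%E =
    (expR (t * m + t ^+ 2 * s ^+ 2 / 2))%:E.
  rewrite (transfer (fun x => expR (t * x)))//.
  by rewrite lawE normal_prob_mgf.
have s_gt0 : 0 < s by rewrite lt_def s_neq0.
have s2 : 0 < s ^+ 2 by exact: exprn_gt0.
(* 1 + t E Y <= E exp(t Y) for all t forces the mean to vanish. *)
have m0 : m = 0.
  have := ge1 _ _ (mgf (- m / s ^+ 2)); rewrite -[leLHS]expR0 ler_expR.
  rewrite (_ : _ + _ = - (m ^+ 2 / (2 * s ^+ 2))); last by field.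
  rewrite oppr_ge0 pmulr_lle0 ?invr_gt0 ?mulr_gt0// => m2.
  by apply/eqP; rewrite -sqrf_eq0 eq_le m2 sqr_ge0.
rewrite (_ : (fun w => _) = (fun w => expR (1 * Y w))); last first.
  by apply/funext => w; rewrite mul1r.
rewrite mgf m0 lee_fin ler_expR mulr0 add0r expr1n mul1r.
suff : s ^+ 2 <= v by lra.
(* The variance is recovered from E exp(- e Y^2 / 2) as e tends to 0. *)
have small (e : R) : 0 < e -> e * v < 2 ->
    (1 - e * v / 2) ^+ 2 * (1 + e * s ^+ 2) <= 1.
  move=> e0 ev2.
  set q := fun w => expR (- (e * Y w ^+ 2 / 2)).
  have mq : measurable_fun [set: T] q.
    do 2 apply: measurableT_comp => //.
    apply: measurable_funM => //; apply: measurable_funM => //.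
    exact: measurable_funX.
  have Eq : 'E_P[q]%E = ((Num.sqrt (1 + e * s ^+ 2))^-1)%:E.
    rewrite (transfer (fun x => expR (- (e * x ^+ 2 / 2))))//.
    - by rewrite lawE m0 normal_prob0_expR_sqr.
    - do 2 apply: measurableT_comp => //.
      by apply: measurable_funM => //; apply: measurable_funM.
  have : (1%:E <= 'E_P[fun w => (q w + e / 2 * Y w ^+ 2)%R])%E.
    rewrite -(@expectation_cst _ _ _ P); apply: expectation_le => //.
    - apply: measurable_funD => //; apply: measurable_funM => //.
      exact: measurable_funX.
    - by move=> w; rewrite addr_ge0 ?expR_ge0// mulr_ge0 ?sqr_ge0//; lra.
    - apply: aeW => w /=; rewrite -lerBlDr.
      by rewrite [leRHS](_ : _ = expR (- (e / 2 * Y w ^+ 2)));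
        [exact: expR_ge1Dx | congr expR; ring].
  rewrite unlock; under eq_integral do rewrite EFinD EFinM.
  rewrite ge0_integralD//=; last 4 first.
  - by move=> w _; rewrite lee_fin expR_ge0.
  - exact/measurable_EFinP.
  - by move=> w _; rewrite -EFinM lee_fin mulr_ge0 ?sqr_ge0//; lra.
  - apply: emeasurable_funM => //; exact/measurable_EFinP/measurable_funX.
  rewrite integralZl//; move: Eq EY2; rewrite unlock => -> ->.
  rewrite -EFinM -EFinD lee_fin.
  set k := Num.sqrt _.
  have k2 : k ^+ 2 = 1 + e * s ^+ 2.
    by rewrite sqr_sqrtr// addr_ge0// mulr_ge0 ?sqr_ge0// ltW.
  have k0 : 0 < k by rewrite sqrtr_gt0 ltr_pwDl// mulr_ge0 ?sqr_ge0// ltW.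
  rewrite -k2 -exprMn => h.
  have ev0 : 0 <= 1 - e * v / 2 by rewrite subr_ge0 ler_pdivrMr// mul1r ltW.
  apply: exprn_ile1; first by rewrite mulr_ge0// ltW.
  by rewrite -ler_pdivlMr// div1r; lra.
(* Suppose v < S = s^2. The left side of [small] is at least 1 + e (S - v - e v S), which exceeds 1
   once e v S < S - v; the denominator D is large enough for this and for e v < 2. *)
rewrite leNgt; apply/negP => vs.
set S := s ^+ 2 in s2 small vs *.
pose D := 2 * (v + 1) * (S + 1).
have D0 : 0 < D by rewrite /D !mulr_gt0//; lra.
pose e := (S - v) / D.
have e0 : 0 < e by rewrite divr_gt0// subr_gt0.
have eE : e * D = S - v by rewrite divfK// gt_eqF.
have vS : v * S < D.
  by rewrite /D; have := mulr_ge0 v0 (ltW s2); lra.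
have evS : e * (v * S) < S - v by rewrite -eE ltr_pM2l.
have ev2 : e * v < 2.
  suff : e * v * D < 1 * D by rewrite ltr_pM2r//; lra.
  by rewrite mulrAC eE; have := sqr_ge0 v; lra.
have e2v0 : 0 <= e ^+ 2 * v ^+ 2 * (1 + e * S).
  apply: mulr_ge0; first by rewrite mulr_ge0 ?sqr_ge0.
  by have := mulr_gt0 e0 s2; lra.
have evS' : 0 < e * (S - v - e * (v * S)) by rewrite mulr_gt0// subr_gt0.
have := small _ e0 ev2; lra.
Qed.
End gaussian.

(** * Convexity of powers and power sums *)

Section powR.
Context (R : realType).
Implicit Types (a b h p x y u e : R).

(** This is Young's inequality for y and x^(b - 1), with conjugate exponents b and b / (b - 1); no
    derivative is taken. *)
Lemma powR_tangent b x y : 1 < b -> 0 <= x -> 0 <= y ->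
  x `^ b + b * x `^ (b - 1) * (y - x) <= y `^ b.
Proof.
move=> b1 x0 y0; have b0 : 0 < b by exact: lt_trans b1.
have c0 : 0 < b - 1 by rewrite subr_gt0.
have young : y * x `^ (b - 1) <= y `^ b / b + x `^ b / (b / (b - 1)).
  have -> : x `^ b = (x `^ (b - 1)) `^ (b / (b - 1)).
    by rewrite -powRrM mulrC divfK// gt_eqF.
  apply: conjugate_powR => //; first exact: powR_ge0.
    by rewrite divr_gt0.
  by field; rewrite !gt_eqF.
have xb : x `^ b = x * x `^ (b - 1) by rewrite mulr_powRB1.
have := ler_wpM2l (ltW b0) young.
rewrite (_ : b * (_ + _) = y `^ b + (b - 1) * x `^ b); last first.
  by field; rewrite !gt_eqF.
by rewrite xb; lra.
Qed.

(** The tangent inequalities at |x| are added; their linear terms have a nonnegative sum because |x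
    + e| + |x - e| >= 2 |x|. *)
Lemma powR_midpoint b x e : 1 < b ->
  2 * `|x| `^ b <= `|x + e| `^ b + `|x - e| `^ b.
Proof.
move=> b1.
have := powR_tangent b1 (normr_ge0 x) (normr_ge0 (x + e)).
have := powR_tangent b1 (normr_ge0 x) (normr_ge0 (x - e)).
have : 0 <= b * `|x| `^ (b - 1) * (`|x + e| + `|x - e| - 2 * `|x|).
  apply: mulr_ge0; first by rewrite mulr_ge0 ?powR_ge0//; lra.
  have := ler_normD (x + e) (x - e).
  rewrite (_ : x + e + (x - e) = 2 * x); last by ring.
  by rewrite normrM ger0_norm//; lra.
lra.
Qed.

(** Discrete comparison with the integral of x^(-p). The inductive step (1 - p) (n + 1)^(-p) <= (n +
    1)^(1 - p) - n^(1 - p) is the tangent inequality for the exponent 1 / (1 - p). *)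
Lemma sum_powRN_le p n : 0 < p < 1 ->
  \sum_(i < n) (i.+1%:R : R) `^ (- p) <= n%:R `^ (1 - p) / (1 - p).
Proof.
move=> /andP[p0 p1]; have a0 : 0 < 1 - p by rewrite subr_gt0.
elim: n => [|n ih]; first by rewrite big_ord0 divr_ge0 ?powR_ge0// ltW.
rewrite big_ord_recr/=; apply: (le_trans (lerD ih (lexx _))).
rewrite -lerBrDl -mulrBl ler_pdivlMr//.
have b1 : 1 < (1 - p)^-1 by rewrite invf_gt1//; lra.
have := powR_tangent b1 (powR_ge0 n.+1%:R (1 - p)) (powR_ge0 n%:R (1 - p)).
rewrite -!powRrM mulfV ?gt_eqF// !powRr1//.
rewrite (_ : (1 - p) * ((1 - p)^-1 - 1) = p); last by field; rewrite gt_eqF.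
have q0 : 0 < n.+1%:R `^ p :> R by rewrite powR_gt0.
rewrite [_ `^ (- p)]powRN [X in _ -> X <= _]mulrC ler_pdivrMr//.
move: (_ `^ (1 - p)) (_ `^ (1 - p)) => u v.
move: (n.+1%:R `^ p : R) q0 => q q0 T.
have := ler_wpM2l (ltW a0) T.
rewrite mulrDr [_ * (_ * q * _)](_ : _ = q * (v - u)); last first.
  by field; rewrite gt_eqF.
by rewrite -natr1; lra.
Qed.

Lemma cvg_powRN h : 0 < h -> (n.+1%:R : R) `^ (- h) @[n --> \oo] --> (0 : R).
Proof.
move=> h0.
have : (n.+1%:R^-1 : R) `^ h @[n --> \oo] --> (0 : R).
  apply: (cvg_comp (fun n => n.+1%:R^-1 : R) (@powR R ^~ h)); last first.
    exact: powR_cvg0.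
  move=> A [e /= e0 eA].
  have [N _ HN] :=
    (@cvgr0_norm_lt _ _ _ _ _ (@harmonic R) (@cvg_harmonic R) _ e0).
  exists N => // n /= Nn; apply: eA => //=.
  by rewrite sub0r normrN; exact: HN.
by under eq_fun do rewrite -powR_inv1// -powRrM mulN1r.
Qed.
End powR.

(** * Geometric decay against subexponential growth *)

Section limit.
Context (R : realType).

Lemma prod_expR_powR_cvg0 (w : nat -> R) (D C l a : R) :
  (forall k, 0 <= w k) -> w n @[n --> \oo] --> l -> 0 <= l -> l < 1 ->
  0 <= D -> 0 <= C -> a < 1 ->
  D * \prod_(k < n.+1) w k * expR (C * n.+1%:R `^ a) @[n --> \oo] --> (0 : R).
Proof.
move=> w0 wl l0 l1 D0 C0 a1.
have [r [r0 r1 lr]] : exists r, [/\ 0 < r, r < 1 & l < r].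
  by exists ((1 + l) / 2); split; lra.
(* Half the decay rate of r is spent on the exponential factor: r exp(e) = exp(- e) < 1. *)
pose e := - ln r / 2.
have e0 : 0 < e.
  by rewrite /e; have := ln_lt0 (x := r); rewrite r0 r1 => /(_ isT); lra.
have rE : r = expR (- (2 * e)) by rewrite /e mulrCA divff// mulr1 opprK lnK.
have : \forall n \near \oo, w n < r.
  by apply: (cvgr_lt l).
move=> [N1 _ HN1].
(* The denominator C + 1 covers C = 0. *)
have eC : 0 < e / (C + 1) by rewrite divr_gt0//; lra.
have a1' : 0 < 1 - a by rewrite subr_gt0.
have /cvgr0_norm_lt/(_ _ eC)[N2 _ HN2] := cvg_powRN a1'.
have powbound n : (N2 <= n)%N -> C * n.+1%:R `^ a <= e * n.+1%:R.
  move=> N2n; have := HN2 n N2n; rewrite /= ger0_norm ?powR_ge0//.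
  rewrite opprB powRB ?pnatr_eq0 ?implybT// powRr1//.
  have n0 : 0 < n.+1%:R :> R by [].
  rewrite ltr_pdivrMr// mulrAC ltr_pdivlMr; last lra.
  by have := powR_ge0 (n.+1%:R : R) a; lra.
pose N := maxn N1 N2.
have P0 n : 0 <= \prod_(k < n) w k by apply: prodr_ge0.
have prodbound m : \prod_(k < N + m) w k <= \prod_(k < N) w k * r ^+ m.
  elim: m => [|m ih]; first by rewrite addn0 mulr1.
  rewrite addnS big_ord_recr/= exprSr mulrA ler_pM//.
    by rewrite prodr_ge0.
  by apply/ltW/HN1 => /=; rewrite (leq_trans (leq_maxl N1 N2))// leq_addr.
rewrite -(cvg_shiftn N).
pose K := D * \prod_(k < N) w k * expR (e * N%:R) * (r * expR e).
have K0 : 0 <= K by rewrite /K !mulr_ge0 ?expR_ge0 ?P0// ltW.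
apply: (@squeeze_cvgr _ _ _ _ (cst 0) (geometric K (r * expR e))).
- near=> m; rewrite /= !mulr_ge0 ?expR_ge0 ?P0//=.
  have h1 := powbound (m + N)%N (leq_trans (leq_maxr N1 N2) (leq_addl _ _)).
  rewrite -ler_expR in h1.
  have h2 := prodbound m.+1.
  rewrite addnS addnC in h2.
  have h3 : expR (e * (m + N).+1%:R) = expR (e * N%:R) * expR e * expR e ^+ m.
    by rewrite -expRM_natr -!expRD; congr expR; rewrite -natr1 natrD; ring.
  rewrite h3 in h1.
  apply: (@le_trans _ _ (D * (\prod_(k < N) w k * r ^+ m.+1) *
      (expR (e * N%:R) * expR e * expR e ^+ m))).
    apply: ler_pM; rewrite ?mulr_ge0 ?expR_ge0 ?P0//.
    by rewrite ler_wpM2l.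
  by apply: eq_ler; rewrite /geometric /= /K exprS exprMn; ring.
- exact: cvg_cst.
- apply: cvg_geometric.
  rewrite rE -expRD ger0_norm ?expR_ge0//.
  rewrite -[ltRHS]expR0 ltr_expR; lra.
Unshelve. all: by end_near. Qed.
End limit.

(** * Covariances of the increments *)

Section increments.
Context (R : realType).
Variables (b dt : R).

(** For b = 2H, the covariance of B^H at the times i dt and j dt. *)
Definition grid_cov (i j : nat) : R := 2^-1 *
  ((i%:R * dt) `^ b + (j%:R * dt) `^ b - `|i%:R * dt - j%:R * dt| `^ b).

(** For b = 2H, the covariance s_ij of V_i and V_j, by bilinearity. *)
Definition incr_cov (i j : nat) : R := grid_cov i.+1 j.+1 -
  grid_cov i.+1 j - grid_cov i j.+1 + grid_cov i j.

Lemma incr_covC i j : incr_cov i j = incr_cov j i.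
Proof.
have gC k l : grid_cov k l = grid_cov l k.
  by rewrite /grid_cov distrC [X in X - _]addrC.
by rewrite /incr_cov gC (gC i.+1) (gC i j.+1) (gC i j); ring.
Qed.

(** The one-time powers cancel and leave half the second difference of |x|^b at (i - j) dt, which is
    nonnegative by convexity. *)
Lemma incr_cov_ge0 i j : 1 < b -> 0 <= incr_cov i j.
Proof.
move=> b1.
have := powR_midpoint (i%:R * dt - j%:R * dt) dt b1.
have succ k : k.+1%:R * dt = k%:R * dt + dt by rewrite -natr1 mulrDl mul1r.
rewrite /incr_cov /grid_cov !succ.
move: (i%:R * dt) (j%:R * dt) => u v.
rewrite (_ : u + dt - (v + dt) = u - v); last by ring.
rewrite (_ : u + dt - v = u - v + dt); last by ring.
rewrite (_ : u - (v + dt) = u - v - dt); last by ring.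
lra.
Qed.

(** The sum telescopes in j, and its lower end vanishes because [grid_cov k 0] is 0. *)
Lemma sum_incr_cov i n : 1 < b -> 0 < dt ->
  \sum_(j < n) incr_cov i j = grid_cov i.+1 n - grid_cov i n.
Proof.
move=> b1 dt0.
have b0 : 0 < b by exact: lt_trans b1.
have g0 k : grid_cov k 0 = 0.
  rewrite /grid_cov mul0r subr0 powR0 ?gt_eqF//.
  rewrite ger0_norm; last by rewrite mulr_ge0 ?ler0n ?ltW.
  by rewrite addr0 subrr mulr0.
elim: n => [|n ih]; first by rewrite big_ord0 !g0 subrr.
by rewrite big_ord_recr/= ih /incr_cov; ring.
Qed.

Lemma powR_sub_le x y z : 1 < b -> 0 <= y -> y <= x -> x <= z ->
  x `^ b - y `^ b <= b * (x - y) * z `^ (b - 1).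
Proof.
move=> b1 y0 yx xz; have x0 := le_trans y0 yx.
have c0 : 0 <= b - 1 by lra.
have := powR_tangent b1 x0 y0.
have : b * (x - y) * x `^ (b - 1) <= b * (x - y) * z `^ (b - 1).
  rewrite ler_wpM2l//; first by rewrite mulr_ge0//; lra.
  by apply: ge0_ler_powR => //; rewrite nnegrE// (le_trans x0).
lra.
Qed.

(** The telescoped sum is the mean of two differences of b-th powers, each across an interval of
    length dt inside [0, n dt]. *)
Lemma sum_incr_cov_le i n : 1 < b -> 0 < dt -> (i < n)%N ->
  \sum_(j < n) incr_cov i j <= b * dt * dt `^ (b - 1) * n%:R `^ (b - 1).
Proof.
move=> b1 dt0 lin; rewrite sum_incr_cov// /grid_cov.
have iin : i.+1%:R <= n%:R :> R by rewrite ler_nat.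
have i0 : 0 <= i%:R :> R by [].
have lein : i.+1%:R * dt <= n%:R * dt by rewrite ler_pM2r.
have idt : 0 <= i%:R * dt by rewrite mulr_ge0// ltW.
have idt1 : i.+1%:R * dt = i%:R * dt + dt by rewrite -natr1 mulrDl mul1r.
rewrite (_ : _ * n%:R `^ _ = b * dt * (n%:R * dt) `^ (b - 1)); last first.
  by rewrite powRM ?(ltW dt0)//; ring.
have h1 : (i.+1%:R * dt) `^ b - (i%:R * dt) `^ b <=
    b * dt * (n%:R * dt) `^ (b - 1).
  by have := @powR_sub_le (i.+1%:R * dt) (i%:R * dt) (n%:R * dt);
     rewrite idt1 addrAC subrr add0r; apply=> //; rewrite -?idt1//; lra.
have h2 : (n%:R * dt - i%:R * dt) `^ b - (n%:R * dt - i.+1%:R * dt) `^ b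
    <= b * dt * (n%:R * dt) `^ (b - 1).
  have := @powR_sub_le (n%:R * dt - i%:R * dt) (n%:R * dt - i.+1%:R * dt)
    (n%:R * dt).
  rewrite [_ - _ - (_ - _)](_ : _ = dt); last by rewrite idt1; ring.
  by apply; lra.
rewrite ![`|_ - n%:R * dt|]distrC !ger0_norm ?subr_ge0//; last lra.
lra.
Qed.

(** By c_i c_j <= (c_i^2 + c_j^2) / 2, with nonnegativity and symmetry of the covariances, the
    quadratic form reduces to row sums. *)
Lemma sum_sum_incr_cov_le (c : nat -> R) n : 1 < b ->
  \sum_(i < n) \sum_(j < n) c i * c j * incr_cov i j <=
  \sum_(i < n) c i ^+ 2 * \sum_(j < n) incr_cov i j.
Proof.
move=> b1.
have <- : \sum_(i < n) \sum_(j < n)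
      2^-1 * (c i ^+ 2 + c j ^+ 2) * incr_cov i j =
    \sum_(i < n) c i ^+ 2 * \sum_(j < n) incr_cov i j.
  under eq_bigr do under eq_bigr do rewrite [2^-1 * _]mulrDr mulrDl.
  under eq_bigr do rewrite big_split/=.
  rewrite big_split/= [X in _ + X]exchange_big/= -big_split/=.
  apply: eq_bigr => i _; rewrite -big_split/= mulr_sumr.
  by apply: eq_bigr => j _; rewrite (incr_covC j i); field.
apply: ler_sum => i _; apply: ler_sum => j _.
rewrite ler_wpM2r ?incr_cov_ge0//.
by have := sqr_ge0 (c i - c j); lra.
Qed.

(* The exponent p = (b - 1) (3 - b) of the proof is chosen so that
   b - 1 < p < 1 and p <= 2 (b - 1). *)
Lemma weighted_incr_cov_le (c : nat -> R) (C : R) n :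
  1 < b < 2 -> 0 < dt -> 0 <= C ->
  (forall i, c i ^+ 2 <= C * i.+1%:R `^ (- (2 * (b - 1)))) ->
  \sum_(i < n) \sum_(j < n) c i * c j * incr_cov i j <=
  C * (b * dt * dt `^ (b - 1)) / (1 - (b - 1) * (3 - b)) *
    n%:R `^ (1 - (b - 1) * (2 - b)).
Proof.
move=> /andP[b1 b2] dt0 C0 cC; apply: (le_trans (sum_sum_incr_cov_le c n b1)).
set p := (b - 1) * (3 - b); set S := b * dt * dt `^ (b - 1).
have S0 : 0 <= S by rewrite /S !mulr_ge0 ?powR_ge0//; lra.
have p01 : 0 < p < 1.
  by apply/andP; split; rewrite /p; nra.
(* The case n = 0 is apart because [powRD], used below to split the power of n, needs a nonzero base
   here. *)
have [n0|n0] := posnP n.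
  rewrite n0 big_ord0 mulr_ge0 ?powR_ge0// divr_ge0//.
    exact: mulr_ge0.
  by rewrite subr_ge0 ltW//; case/andP: p01.
(* The exponent 2 (b - 1) may reach or exceed 1, where [sum_powRN_le] does not apply; hence the
   weakening to i^(-p). *)
apply: (@le_trans _ _
    (\sum_(i < n) (C * S * n%:R `^ (b - 1)) * i.+1%:R `^ (- p))).
  apply: ler_sum => i _.
  apply: (@le_trans _ _ (C * i.+1%:R `^ (- p) * (S * n%:R `^ (b - 1)))).
    apply: ler_pM; rewrite ?sqr_ge0//.
    - by apply: sumr_ge0 => j _; exact: incr_cov_ge0.
    - apply: (le_trans (cC i)); rewrite ler_wpM2l//.
      by apply: ler_powR; [rewrite ler1n | rewrite /p; nra].
    - exact: sum_incr_cov_le.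
  by apply: eq_ler; ring.
rewrite -mulr_sumr.
apply: le_trans.
  apply: ler_wpM2l; last exact: (sum_powRN_le n p01).
  exact: mulr_ge0 (mulr_ge0 C0 S0) (powR_ge0 _ _).
rewrite (_ : 1 - (b - 1) * (2 - b) = (b - 1) + (1 - p)); last first.
  by rewrite /p; ring.
rewrite [_ `^ (b - 1 + (1 - p))]powRD; last first.
  by rewrite pnatr_eq0 -lt0n n0 implybT.
move: (1 - p)^-1 (_ `^ (1 - p)) (_ `^ (b - 1)) => u v w.
by apply: eq_ler; ring.
Qed.
End increments.

(** * Expectations of linear combinations and of sign expansions *)

Section expectation.
Context d (T : measurableType d) (R : realType) (P : probability T R).

Lemma expectation_lin (I : finType) (a e : I -> R) (h : I -> T -> R) :
  (forall i, P.-integrable [set: T] (EFin \o h i)) ->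
  (forall i, 'E_P[h i]%E = (e i)%:E) ->
  'E_P[fun w => (\sum_i a i * h i w)%R]%E = (\sum_i a i * e i)%:E.
Proof.
move=> ih eh; rewrite unlock.
under eq_integral do rewrite -sumEFin.
rewrite integral_sum//=; last first.
  move=> i; under eq_fun do rewrite EFinM.
  by apply: integrableZl => //; exact: ih.
rewrite -sumEFin; apply: eq_bigr => i _.
under eq_integral do rewrite EFinM.
rewrite integralZl//; last exact: ih.
by have := eh i; rewrite unlock => ->.
Qed.

(** The product expands into 2^n exponentials, one for each sign pattern, so no independence of the
    V_k is involved. *)
Lemma expectation_prod_expR_le (n : nat) (c : nat -> R) (V : nat -> T -> R)
    (v : R) :
  (forall k, measurable_fun [set: T] (V k)) ->
  (forall s : nat -> R, (forall k, `|s k| = 1) ->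
    ('E_P[fun w => expR (\sum_(k < n) (s k * c k) * V k w)] <=
     (expR v)%:E)%E) ->
  ('E_P[fun w => (\prod_(k < n)
      (expR (c k * V k w) + expR (- (c k * V k w))))%R] <=
   (2 ^+ n * expR v)%:E)%E.
Proof.
move=> mV bound.
have expand w : \prod_(k < n) (expR (c k * V k w) + expR (- (c k * V k w))) =
    \sum_(e : {ffun 'I_n -> bool})
      expR (\sum_(k < n) ((-1) ^+ e k * c k) * V k w).
  have pm x : expR x + expR (- x) = \sum_(y : bool) expR ((-1) ^+ y * x).
    by rewrite big_bool/= expr1 expr0 mulN1r mul1r addrC.
  under eq_bigr do rewrite pm.
  rewrite bigA_distr_bigA/=; apply: eq_bigr => e _.
  rewrite expR_sum; apply: eq_bigr => k _; by rewrite mulrA.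
rewrite unlock; under eq_integral do rewrite expand -sumEFin.
rewrite ge0_integral_sum//=; last first.
  move=> e; apply/measurable_EFinP; apply: measurableT_comp => //.
  by apply: measurable_sum => k; apply: measurable_funM => //; exact: mV.
apply: (@le_trans _ _ (\sum_(e : {ffun 'I_n -> bool}) (expR v)%:E)%E).
  apply: lee_sum => e _.
  (* The signs are extended by 1 beyond n, since [bound] speaks of sequences on all of [nat]. *)
  pose s (k : nat) : R := if insub k is Some i then (-1) ^+ e i else 1.
  have := bound s; rewrite unlock.
  rewrite (_ : (fun w => _) = (fun w =>
      (expR (\sum_(k < n) ((-1) ^+ e k * c k) * V k w))%:E)); last first.
    apply/funext => w; congr (expR _)%:E; apply: eq_bigr => k _.
    by rewrite /s valK.
  apply => k; rewrite /s; case: insubP => [i _ _|_]; rewrite ?normr1//.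
  by rewrite normrX normrN1 expr1n.
rewrite sumEFin sumr_const card_ffun card_bool card_ord.
by rewrite -[expR v *+ _]mulr_natl natrX.
Qed.
End expectation.

(** * Exponential moments of fractional Brownian motion *)

Section fbm.
Context d (T : measurableType d) (R : realType) (P : probability T R).
Variables (H : R) (B : R -> {RV P >-> R}).
Hypothesis hB : fractional_brownian_motion H B.

Let cov (t s : R) : R :=
  2^-1 * (t `^ (2 * H) + s `^ (2 * H) - `|t - s| `^ (2 * H)).

(** The linear combination is centered Gaussian and the double sum is its variance. A general finite
    index type allows indexing by endpoints of increments below. *)
Lemma fbm_mgf_le (I : finType) (a t : I -> R) : (forall i, 0 <= t i) ->
  ('E_P[fun w => expR (\sum_i a i * B (t i) w)] <=
   (expR ((\sum_i \sum_j a i * a j * cov (t i) (t j)) / 2))%:E)%E.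
Proof.
case: hB => gB mB cB t0.
have iB2 (s : R) : 0 <= s ->
    P.-integrable [set: T] (EFin \o (fun w => B s w ^+ 2)).
  move=> s0; apply/integrableP; split.
    by apply/measurable_EFinP; exact: measurable_funX.
  under eq_integral do rewrite /= ger0_norm ?sqr_ge0// expr2.
  by have := cB s s s0 s0; rewrite unlock => ->; rewrite ltry.
have iB (s : R) : 0 <= s -> P.-integrable [set: T] (EFin \o B s).
  by move=> s0; apply: integrable_sqr_integrable => //; exact: iB2.
have iBB (s u : R) : 0 <= s -> 0 <= u ->
    P.-integrable [set: T] (EFin \o (fun w => B s w * B u w)).
  move=> s0 u0.
  apply: (@le_integrable _ _ _ _ _ measurableT _
      (EFin \o (fun w => B s w ^+ 2 + B u w ^+ 2))) => //.
  - by apply/measurable_EFinP; exact: measurable_funM.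
  - move=> w _ /=; rewrite lee_fin normrM [leRHS]ger0_norm; last first.
      by rewrite addr_ge0// sqr_ge0.
    have := sqr_ge0 (`|B s w| - `|B u w|).
    have := real_normK (num_real (B s w)).
    have := real_normK (num_real (B u w)).
    by have := sqr_ge0 (B s w); have := sqr_ge0 (B u w); lra.
  - rewrite (_ : EFin \o _ = (fun w => (B s w ^+ 2)%:E + (B u w ^+ 2)%:E)%E)//.
    by apply: integrableD => //; exact: iB2.
have mY : measurable_fun [set: T] (fun w => \sum_i a i * B (t i) w).
  by apply: measurable_sum => i; exact: measurable_funM.
apply: gaussian_expectation_expR => //.
- have := gB #|I| (a \o enum_val) (t \o enum_val) (fun i => t0 _).
  congr (gaussian_law (pushforward P _)); apply/funext => w.
  rewrite [RHS](reindex (@enum_val I I))//; apply: onW_bij; exact: enum_val_bij.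
- rewrite (@expectation_lin _ _ _ P _ a (fun=> 0) (fun i => B (t i)))//.
  + by rewrite big1// => i _; rewrite mulr0.
  + by move=> i; exact: iB.
  + by move=> i; exact: mB.
- rewrite (_ : (fun w => _) = (fun w => \sum_(ij : I * I)
      (a ij.1 * a ij.2) * (B (t ij.1) w * B (t ij.2) w))); last first.
    apply/funext => w; rewrite expr2 big_distrlr/= pair_bigA/=.
    by apply: eq_bigr => -[i j] _ /=; ring.
  rewrite (@expectation_lin _ _ _ P _ _ (fun ij => cov (t ij.1) (t ij.2))
    (fun ij w => B (t ij.1) w * B (t ij.2) w)).
  + by congr EFin; rewrite pair_bigA.
  + by move=> ij; exact: iBB.
  + by move=> ij; exact: cB.
Qed.

Lemma fbm_incr_mgf_le (dt : R) (n : nat) (a : nat -> R) : 0 < dt ->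
  ('E_P[fun w => expR (\sum_(k < n)
      a k * (B (k.+1%:R * dt) w - B (k%:R * dt) w))] <=
   (expR ((\sum_(i < n) \sum_(j < n)
      a i * a j * incr_cov (2 * H) dt i j) / 2))%:E)%E.
Proof.
move=> dt0.
(* The pair (k, true) stands for the right endpoint of the k-th step, with weight a_k, and (k,
   false) for the left one, with weight - a_k. *)
pose t (i : 'I_n * bool) : R := (i.1 + i.2)%:R * dt.
pose c (i : 'I_n * bool) : R := a i.1 * (-1) ^+ (~~ i.2).
have t0 i : 0 <= t i by rewrite mulr_ge0// ltW.
have sumE (F : 'I_n * bool -> R) :
    \sum_i F i = \sum_(k < n) (F (k, true) + F (k, false)).
  transitivity (\sum_(k < n) \sum_(x : bool) F (k, x)).
    by rewrite pair_bigA; apply: eq_bigr => -[].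
  by under eq_bigr do rewrite big_bool.
have := fbm_mgf_le c t0.
under [X in ('E_P[X] <= _)%E]eq_fun => w.
  rewrite sumE; under eq_bigr => k _.
    rewrite (_ : _ + _ = a k * (B (k.+1%:R * dt) w - B (k%:R * dt) w)).
      over.
    by rewrite /c /t/= addn1 addn0 expr0 expr1; ring.
  over.
move=> /le_trans; apply; rewrite lee_fin ler_expR ler_pM2r//.
apply: eq_ler; rewrite sumE; apply: eq_bigr => i _.
rewrite !sumE -big_split/=; apply: eq_bigr => j _.
rewrite /c /t/= !addn1 !addn0 expr0 expr1 /incr_cov /grid_cov /cov; ring.
Qed.
End fbm.

(** * Elementary estimates for one step of the method *)

(** Multiplying the implicit equation by z gives |z| |y| >= z y = z^2 - th z f1 dt >= (1 + th a)
    z^2. *)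
Lemma implicit_step (R : realType) (th a dt z f1 y : R) :
  0 <= th -> 0 <= a -> z = th * f1 * dt + y -> z * f1 * dt <= - a * z ^+ 2 ->
  `|z| * (1 + th * a) <= `|y|.
Proof.
move=> th0 a0 zE mono.
have [->|z0] := eqVneq z 0; first by rewrite normr0 mul0r.
have nz0 : 0 < `|z| by rewrite normr_gt0.
rewrite -(ler_pM2l nz0) -normrM mulrA -expr2 real_normK ?num_real//.
apply: le_trans (ler_norm _); rewrite (_ : z * y = z ^+ 2 - th * (z * f1 * dt)).
  by have := ler_wpM2l th0 mono; lra.
have -> : y = z - th * f1 * dt by rewrite {1}zE; ring.
ring.
Qed.

(** Applied with h = 2H - 1 and k = kappa - 1, this is where kappa >= 2H yields beta_n = O(n^(-h)).
    The constant makes the right side at least 1 + 2 n^k, and n + 1 <= 2 n for n >= 1. *)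
Lemma damping_decay (R : realType) (h k A : R) (n : nat) :
  0 < h -> h <= 1 -> h <= k -> 0 < A ->
  n.+1%:R `^ h <= (1 + 2 / A) * (1 + A * n%:R `^ k).
Proof.
move=> h0 h1 hk A0.
have A2 : 0 < 2 / A by rewrite divr_gt0.
have nk : 0 <= n%:R `^ k :> R by exact: powR_ge0.
suff : n.+1%:R `^ h <= 1 + 2 * n%:R `^ k.
  rewrite (_ : (1 + 2 / A) * _ = 1 + 2 * n%:R `^ k + (2 / A + A * n%:R `^ k)).
    by have := mulr_ge0 (ltW A0) nk; lra.
  by field; rewrite gt_eqF.
case: n nk => [|n] nk; first by rewrite powR1; lra.
apply: (@le_trans _ _ ((2 * n.+1%:R) `^ h)).
  apply: ge0_ler_powR; rewrite ?nnegrE ?mulr_ge0//; first exact: ltW.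
  by rewrite -natrM ler_nat mul2n -addnn addSn ltnS leq_addl.
rewrite powRM//.
apply: (@le_trans _ _ (2 * n.+1%:R `^ k)); last lra.
apply: ler_pM; rewrite ?powR_ge0//.
  by apply: ler1_powR => //; lra.
by apply: ler_powR => //; rewrite ler1n.
Qed.

Lemma expR_normr_sqr_le (R : realType) (c v : R) : 0 <= c ->
  expR (c * `|v|) ^+ 2 <= expR (2 * c * v) + expR (- (2 * c * v)).
Proof.
move=> c0; rewrite -expRM_natl.
have [v0|v0] := leP 0 v.
  rewrite ger0_norm// mulrA.
  by rewrite lerDl expR_ge0.
rewrite ltr0_norm// mulrA mulrN.
by rewrite lerDr expR_ge0.
Qed.

(** * Pathwise bound and mean square decay *)

Section stability.
Context d (T : measurableType d) (R : realType) (P : probability T R).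
Variables (H : R) (B : R -> {RV P >-> R}) (x0 : R) (f g : R -> R -> R).
Variables (kappa lambda mu dt theta r : R) (X : nat -> {RV P >-> R}).

Let V (n : nat) (w : T) : R := B (n.+1%:R * dt) w - B (n%:R * dt) w.
Let a (n : nat) : R := lambda * kappa * (n%:R * dt) `^ (kappa - 1) * dt.
(** Equal to (1 + r theta a_n) / (1 + theta a_n); this form displays the limit r. *)
Let q (n : nat) : R := r + (1 - r) / (1 + theta * a n).
Let beta (n : nat) : R := mu / r / (1 + theta * a n).

Lemma theta_method_pathwise :
  0 < lambda -> 1 < kappa -> 0 < mu -> 0 < dt -> 0 < theta -> 0 < r < 1 ->
  condM lambda kappa f -> condG mu g ->
  (forall t x, 0 < t -> `|(1 - theta) * f t x| <=
     r * theta * (lambda * kappa * t `^ (kappa - 1)) * `|x|) ->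
  stochastic_theta_method theta f g B dt x0 X ->
  exists2 D : R, 0 <= D & forall n, {ae P, forall w,
    `|X n.+1 w| <= D * \prod_(k < n.+1) (q k * expR (beta k * `|V k w|))}.
Proof.
move=> la0 ka1 mu0 dt0 th0 /andP[r0 r1] hM hG hF [X0 XS].
have a0 n : 0 <= a n by rewrite /a !mulr_ge0 ?powR_ge0//; lra.
have tha n : 0 <= theta * a n by rewrite mulr_ge0// ltW.
have den n : 0 < 1 + theta * a n by rewrite ltr_pwDl.
have step n w : X n.+1 w = X n w + theta * f (n.+1%:R * dt) (X n.+1 w) * dt
      + (1 - theta) * f (n%:R * dt) (X n w) * dt
      + g (n%:R * dt) (X n w) * V n w ->
    `|X n.+1 w| * (1 + theta * a n.+1) <=
    `|X n w + (1 - theta) * f (n%:R * dt) (X n w) * dt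
       + g (n%:R * dt) (X n w) * V n w|.
  move=> E.
  apply: (@implicit_step _ _ _ dt _ (f (n.+1%:R * dt) (X n.+1 w))) => //.
  - exact: ltW.
  - by rewrite {1}E; ring.
  - have t0 : 0 < n.+1%:R * dt by rewrite mulr_gt0.
    have := ler_wpM2r (ltW dt0) (hM _ (X n.+1 w) t0).
    by rewrite /a; lra.
(* The growth conditions hold for t > 0 only, so the values of f and g at time 0 enter the constant
   D. The factor r / mu offsets beta_0 = mu / r. *)
pose K0 := `|x0 + (1 - theta) * f (0%:R * dt) x0 * dt|.
pose K1 := `|g (0%:R * dt) x0|.
pose D := K0 + K1 * (r / mu).
have rmu0 : 0 <= r / mu by rewrite ltW// divr_gt0.
have mur0 : 0 <= mu / r by rewrite ltW// divr_gt0.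
have D0 : 0 <= D by exact: addr_ge0 (normr_ge0 _) (mulr_ge0 (normr_ge0 _) rmu0).
have aO : a 0 = 0.
  by rewrite /a mul0r powR0 ?mulr0 ?mul0r// gt_eqF// subr_gt0.
exists D => // n.
(* The induction runs on Y_(n+1), which keeps the damping factor for the next step. *)
suff : {ae P, forall w, `|X n.+1 w| * (1 + theta * a n.+1) <=
    D * \prod_(k < n.+1) (q k * expR (beta k * `|V k w|))}.
  apply: filterS => w; apply: le_trans.
  by rewrite ler_peMr// lerDl.
elim: n => [|n IH].
  move: (X0) (XS 0); apply: filterS2 => w E0 E1.
  apply: (le_trans (step _ _ E1)); rewrite E0.
  apply: (le_trans (ler_normD _ _)); rewrite normrM -/K0 -/K1.
  rewrite big_ord1 /q /beta aO mulr0 addr0 !divr1 addrCA subrr addr0 mul1r.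
  have x1 : 0 <= mu / r * `|V 0 w| by rewrite mulr_ge0.
  apply: (@le_trans _ _ (D * (1 + mu / r * `|V 0 w|))).
    have e1 : r / mu * (mu / r) = 1 by field; rewrite !gt_eqF.
    rewrite /D mulrDr mulr1 mulrDl.
    rewrite [K1 * _ * _]mulrA -[K1 * _ * _]mulrA e1 mulr1.
    have := mulr_ge0 (normr_ge0 _ : 0 <= K0) x1.
    by have := mulr_ge0 (normr_ge0 _ : 0 <= K1) rmu0; lra.
  by rewrite ler_wpM2l// expR_ge1Dx.
move: (IH) (XS n.+1); apply: filterS2 => w Hn E1.
apply: (le_trans (step _ _ E1)).
have t0 : 0 < n.+1%:R * dt by rewrite mulr_gt0.
rewrite big_ord_recr/= [leRHS]mulrA.
apply: (@le_trans _ _ (`|X n.+1 w| * (1 + theta * a n.+1) *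
    (q n.+1 * expR (beta n.+1 * `|V n.+1 w|)))); last first.
  rewrite ler_wpM2r// mulr_ge0 ?expR_ge0// /q addr_ge0 ?(ltW r0)//.
  by rewrite divr_ge0// ?(ltW (den _))// subr_ge0 ltW.
apply: (@le_trans _ _
    (`|X n.+1 w| * (1 + r * (theta * a n.+1) + mu * `|V n.+1 w|))).
  apply: (le_trans (ler_normD _ _)); rewrite [leRHS]mulrDr lerD//; last first.
    rewrite normrM mulrCA mulrA.
    by rewrite ler_wpM2r// hG.
  apply: (le_trans (ler_normD _ _)); rewrite [leRHS]mulrDr mulr1 lerD//.
  rewrite normrM (gtr0_norm dt0).
  have := ler_wpM2r (ltW dt0) (hF _ (X n.+1 w) t0).
  by rewrite /a; lra.
rewrite -mulrA ler_wpM2l//.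
set e := expR _; set s := theta * a n.+1.
have s0 : 0 <= s by exact: tha.
have qE : (1 + s) * q n.+1 = 1 + r * s.
  by rewrite /q -/s; field; rewrite gt_eqF// ltr_pwDl.
(* As r < 1, mu = (r + r s) beta <= (1 + r s) beta, so 1 + r s + mu |V| <= (1 + r s) (1 + beta
   |V|). *)
have bE : mu = r * (beta n.+1 * (1 + s)).
  by rewrite /beta -/s; field; rewrite !gt_eqF// ltr_pwDl.
rewrite [leRHS]mulrA qE.
have eb : 1 + beta n.+1 * `|V n.+1 w| <= e by exact: expR_ge1Dx.
apply: (@le_trans _ _
    ((1 + r * s) * (1 + beta n.+1 * `|V n.+1 w|))); last first.
  by rewrite ler_wpM2l// addr_ge0// mulr_ge0// ltW.
rewrite mulrDr mulr1 lerD2l {1}bE.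
have b0 : 0 <= beta n.+1 * `|V n.+1 w|.
  by rewrite mulr_ge0// /beta !divr_ge0// ltW.
rewrite (_ : _ * _ * `|_| = (r + r * s) * (beta n.+1 * `|V n.+1 w|)); last first.
  by ring.
by rewrite ler_wpM2r// lerD2r ltW.
Qed.

Hypothesis hB : fractional_brownian_motion H B.

(** The bound on [(1 - theta) * f t x] treats both cases at once: its left side is 0 for theta = 1.
    The condition 2 r^2 < 1 lets q_k^2, which tends to r^2, beat the factor 2 per step from the
    signs. *)
Lemma theta_method_stable :
  2^-1 < H < 1 -> 2 * H <= kappa ->
  0 < lambda -> 0 < mu -> 0 < dt -> 0 < theta -> 0 < r -> 2 * r ^+ 2 < 1 ->
  condM lambda kappa f -> condG mu g ->
  (forall t x, 0 < t -> `|(1 - theta) * f t x| <=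
     r * theta * (lambda * kappa * t `^ (kappa - 1)) * `|x|) ->
  stochastic_theta_method theta f g B dt x0 X ->
  mean_square_stable X.
Proof.
move=> /andP[H1 H2] hk la0 mu0 dt0 th0 r0 r2 hM hG hF hX.
have r1 : r < 1.
  rewrite ltNge; apply/negP => r1; have := ler_pM ler01 ler01 r1 r1.
  by rewrite -expr2; lra.
have r01 : 0 < r < 1 by rewrite r0.
have b12 : 1 < 2 * H < 2 by apply/andP; split; lra.
have ka1 : 1 < kappa by lra.
have [D D0 path] := theta_method_pathwise la0 ka1 mu0 dt0 th0 r01 hM hG hF hX.
have a0 n : 0 <= a n by rewrite /a !mulr_ge0 ?powR_ge0//; lra.
have den n : 0 < 1 + theta * a n by rewrite ltr_pwDl// mulr_ge0// ltW.
pose h := 2 * H - 1.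
have h0 : 0 < h by rewrite /h; lra.
pose A := theta * (lambda * kappa * dt `^ (kappa - 1) * dt).
have A0 : 0 < A.
  by rewrite /A !mulr_gt0 ?powR_gt0//; lra.
pose K := 1 + 2 / A.
have K0 : 0 < K by rewrite /K ltr_pwDl// divr_ge0// ltW.
have decay n : (1 + theta * a n)^-1 <= K * n.+1%:R `^ (- h).
  have n0 : 0 < n.+1%:R `^ h :> R by rewrite powR_gt0.
  rewrite powRN -[leLHS]mul1r ler_pdivrMr// mulrAC ler_pdivlMr// mul1r.
  have -> : theta * a n = A * n%:R `^ (kappa - 1).
    by rewrite /a /A powRM ?(ltW dt0)//; ring.
  by apply: damping_decay; rewrite // /h; lra.
have q0 n : 0 <= q n.
  by rewrite /q addr_ge0 ?(ltW r0)// divr_ge0 ?(ltW (den _))// subr_ge0 ltW.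
have b0 n : 0 <= beta n.
  by rewrite /beta !divr_ge0// ?ltW.
have mur0 : 0 <= mu / r by rewrite ltW// divr_gt0.
(* The 2 comes from squaring exp(beta_n |V_n|). *)
pose c (n : nat) := 2 * beta n.
have c0 n : 0 <= c n by rewrite /c mulr_ge0.
pose C := (2 * (mu / r) * K) ^+ 2.
have C0 : 0 <= C by rewrite /C sqr_ge0.
have cC i : c i ^+ 2 <= C * i.+1%:R `^ (- (2 * (2 * H - 1))).
  have -> : - (2 * (2 * H - 1)) = - h * 2%:R by rewrite /h; ring.
  rewrite powRrM powR_mulrn ?powR_ge0// /C -exprMn ler_sqr ?nnegrE//; last first.
    apply: mulr_ge0 (powR_ge0 _ _); apply: mulr_ge0 (ltW K0).
    exact: mulr_ge0.
  rewrite /c /beta mulrA -[leRHS]mulrA ler_wpM2l//.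
  exact: mulr_ge0.
(* C1 and e are the constant and the exponent of [weighted_incr_cov_le] for b = 2H. *)
pose C1 := C * (2 * H * dt * dt `^ (2 * H - 1)) /
  (1 - (2 * H - 1) * (3 - 2 * H)).
pose e := 1 - (2 * H - 1) * (2 - 2 * H).
have bound n : ('E_P[fun w => (`|X n.+1 w| ^+ 2)%R] <=
    (D ^+ 2 * \prod_(k < n.+1) (2 * q k ^+ 2) *
     expR (C1 / 2 * n.+1%:R `^ e))%:E)%E.
  pose G (w : T) :=
    \prod_(k < n.+1) (expR (c k * V k w) + expR (- (c k * V k w))).
  have mV k : measurable_fun [set: T] (V k) by exact: measurable_funB.
  have mG : measurable_fun [set: T] G.
    apply: measurable_prod => k _; apply: measurable_funD.
      by apply: measurableT_comp => //; exact: measurable_funM.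
    by do 2 apply: measurableT_comp => //; exact: measurable_funM.
  have G0 w : 0 <= G w.
    by apply: prodr_ge0 => k _; rewrite addr_ge0// expR_ge0.
  have Q0 : 0 <= D ^+ 2 * \prod_(k < n.+1) q k ^+ 2.
    by rewrite mulr_ge0 ?sqr_ge0// prodr_ge0// => k _; rewrite sqr_ge0.
  apply: (@le_trans _ _
      ('E_P[fun w => ((D ^+ 2 * \prod_(k < n.+1) q k ^+ 2) * G w)%R])%E).
    apply: expectation_le => //.
    - by apply: measurable_funX; exact: measurableT_comp.
    - exact: measurable_funM.
    - by move=> w; rewrite mulr_ge0.
    - have := path n; apply: filterS => w Xw.
      rewrite -mulrA -big_split/=.
      apply: (@le_trans _ _
          ((D * \prod_(k < n.+1) (q k * expR (beta k * `|V k w|))) ^+ 2)).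
        rewrite ler_sqr ?nnegrE// mulr_ge0// prodr_ge0// => k _.
        by rewrite mulr_ge0 ?expR_ge0.
      rewrite exprMn -prodrXl ler_wpM2l ?sqr_ge0//.
      apply: ler_prod => k _; rewrite sqr_ge0/= exprMn ler_wpM2l ?sqr_ge0//.
      exact: expR_normr_sqr_le.
  have mgf : ('E_P[G] <= (2 ^+ n.+1 * expR (C1 * n.+1%:R `^ e / 2))%:E)%E.
    apply: expectation_prod_expR_le => // s s1.
    apply: (le_trans (fbm_incr_mgf_le hB n.+1 (fun k => s k * c k) dt0)).
    rewrite lee_fin ler_expR ler_pM2r//.
    apply: le_trans (weighted_incr_cov_le n.+1 b12 dt0 C0 cC).
    (* Since the covariances are nonnegative, the all-plus pattern dominates every sign pattern. *)
    apply: ler_sum => i _; apply: ler_sum => j _.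
    rewrite ler_wpM2r ?incr_cov_ge0//; first by case/andP: b12.
    apply: (le_trans (ler_norm _)).
    rewrite normrM [`|s i * _|]normrM [`|s j * _|]normrM !s1 !mul1r.
    by rewrite (ger0_norm (c0 i)) (ger0_norm (c0 j)).
  rewrite unlock; under eq_integral do rewrite EFinM.
  rewrite ge0_integralZl//=; last 2 first.
  - exact/measurable_EFinP.
  - by move=> w _; rewrite lee_fin.
  move: mgf; rewrite unlock => mgf.
  apply: (@le_trans _ _ ((D ^+ 2 * \prod_(k < n.+1) q k ^+ 2)%:E *
      (2 ^+ n.+1 * expR (C1 * n.+1%:R `^ e / 2))%:E)%E).
    by apply: lee_wpmul2l => //; rewrite lee_fin.
  rewrite -EFinM lee_fin [in leRHS]big_split/= prodr_const card_ord.
  apply: eq_ler.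
  rewrite (_ : C1 * _ / 2 = C1 / 2 * n.+1%:R `^ e); ring.
rewrite /mean_square_stable -cvg_shiftS.
pose u (n : nat) : R := D ^+ 2 * \prod_(k < n.+1) (2 * q k ^+ 2) *
     expR (C1 / 2 * n.+1%:R `^ e).
have cvgu : (u n)%:E @[n --> \oo] --> 0%:E.
  apply: cvg_EFin; first by near=> n.
  apply: (@prod_expR_powR_cvg0 _ (fun k => 2 * q k ^+ 2) _ _ (2 * r ^+ 2)).
  + by move=> k; rewrite mulr_ge0// sqr_ge0.
  + have c0' : (1 + theta * a n)^-1 @[n --> \oo] --> (0 : R).
      apply: (@squeeze_cvgr _ _ _ _ (cst 0) (fun n => K * n.+1%:R `^ (- h))).
      - by near=> n; rewrite /= decay andbT invr_ge0 ltW.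
      - exact: cvg_cst.
      - rewrite -[X in _ --> X](mulr0 K); apply: cvgMr; exact: cvg_powRN.
    have -> : 2 * r ^+ 2 = 2 * (r + (1 - r) * 0) ^+ 2 by rewrite mulr0 addr0.
    apply: cvgMr.
    apply: (@cvg_comp _ _ _ q (fun x => x ^+ 2) _ (nbhs (r + (1 - r) * 0))).
      by apply: cvgD; [exact: cvg_cst|exact: cvgMr].
    exact: sqr_continuous.
  + by rewrite mulr_ge0// sqr_ge0.
  + by [].
  + exact: sqr_ge0.
  + have S0 : 0 <= 2 * H * dt * dt `^ (2 * H - 1).
      by rewrite mulr_ge0 ?powR_ge0// mulr_ge0//; lra.
    apply: divr_ge0 => //; apply: divr_ge0; first exact: mulr_ge0.
    rewrite (_ : 1 - _ = (2 - 2 * H) ^+ 2); last by ring.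
    exact: sqr_ge0.
  + rewrite /e; have : 0 < (2 * H - 1) * (2 - 2 * H) by rewrite mulr_gt0//; lra.
    lra.
apply: (squeeze_cvge _ (cvg_cst 0%:E) cvgu); near=> n.
rewrite bound andbT; apply: expectation_ge0 => w; exact: sqr_ge0.
Unshelve. all: by end_near. Qed.
End stability.

(** * The backward Euler method and the range of theta *)

Unset Implicit Arguments.

Theorem theorem1p2 (d : measure_display) (T : measurableType d) (R : realType)
    (P : probability T R) (H : R) (hH : 2^-1 < H < 1)
    (B : R -> {RV P >-> R}) (hB : fractional_brownian_motion H B)
    (x0 : R) (hx0 : x0 != 0) (f g : R -> R -> R)
    (kappa lambda lambdabar mu : R)
    (hkappa : 2 * H <= kappa) (hlambda : 0 < lambda)
    (hlambdabar : 0 < lambdabar) (hmu : 0 < mu)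
    (hcase : 2 * H < kappa \/ (kappa = 2 * H /\ - lambda + mu ^+ 2 < 0))
    (dt : R) (hdt : 0 < dt) :
  (condM lambda kappa f -> condG mu g ->
     forall X : nat -> {RV P >-> R},
       stochastic_theta_method 1 f g B dt x0 X -> mean_square_stable X)
  /\
  (condM lambda kappa f -> condF lambdabar kappa f -> condG mu g ->
     forall theta : R,
       Num.sqrt 6 * expR 1 * lambdabar / lambda
         / (Num.sqrt 6 * expR 1 * lambdabar / lambda + 1) <= theta ->
       theta < 1 ->
     forall X : nat -> {RV P >-> R},
       stochastic_theta_method theta f g B dt x0 X -> mean_square_stable X).
Proof.
have kappa0 : 0 <= kappa by case/andP: hH; lra.
set s := Num.sqrt 6 * expR 1.
have s60 : 0 < Num.sqrt (6 : R) by rewrite sqrtr_gt0.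
have s0 : 0 < s by rewrite mulr_gt0// expR_gt0.
have r0 : 0 < s^-1 by rewrite invr_gt0.
(* With r = 1 / s, 2 r^2 = 1 / (3 e^2). *)
have r2 : 2 * s^-1 ^+ 2 < 1.
  rewrite exprVn ltr_pdivrMr ?exprn_gt0// mul1r exprMn sqr_sqrtr//.
  have : 1 <= expR 1 ^+ 2 :> R by rewrite exprn_ege1// -[leLHS]expR0 ler_expR.
  lra.
clearbody s; split=> [hM hG X hX|hM hF hG theta hth th1 X hX].
  apply: (theta_method_stable hB hH hkappa hlambda hmu hdt ltr01 r0 r2 hM hG
    _ hX).
  move=> t x t0; rewrite subrr mul0r normr0 !mulr_ge0 ?powR_ge0// ltW//.
have A0 : 0 < s * lambdabar / lambda by rewrite divr_gt0// mulr_gt0.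
have th0 : 0 < theta by apply: lt_le_trans hth; rewrite divr_gt0// addr_gt0.
apply: (theta_method_stable hB hH hkappa hlambda hmu hdt th0 r0 r2 hM hG _ hX).
move=> t x t0.
have w0 : 0 <= kappa * t `^ (kappa - 1) * `|x| by rewrite !mulr_ge0 ?powR_ge0.
(* With rho = s lambdabar / lambda, theta >= rho / (rho + 1) means (1 - theta) rho <= theta, which
   is this inequality up to scaling. *)
have weight : (1 - theta) * lambdabar <= s^-1 * theta * lambda.
  move: hth; rewrite ler_pdivrMr; last by rewrite addr_gt0.
  rewrite -(ler_pM2r hlambda) -(ler_pM2r r0) => hth.
  have e1 : s * lambdabar / lambda * lambda / s = lambdabar.
    by field; rewrite !gt_eqF.
  have e2 : theta * (s * lambdabar / lambda + 1) * lambda / s =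
      theta * lambdabar + s^-1 * theta * lambda.
    by field; rewrite !gt_eqF.
  by rewrite e1 e2 in hth; lra.
have h1 : 0 <= 1 - theta by rewrite subr_ge0 ltW.
rewrite normrM (ger0_norm h1); apply: (le_trans (ler_wpM2l h1 (hF t x t0))).
have := ler_wpM2r w0 weight; rewrite !mulrA; lra.
Qed.
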